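(* Let $K$ be a field, $n$ an integer, $1\leq k\leq n-1$, and let $I=I_{L_k}\subset K[L_k]$ be the join-meet ideal of the lattice $L_k$. The minimal primes of $I$ are the following: $$P=(I, z-x_{k+1},z-y_k),\quad P_1=(z,x_1,\ldots,x_n),\quad P_1'=(z,y_1,\ldots,y_n),$$ $$P_2=(z,x_1,\ldots,x_k,y_1,\ldots,y_k)+I_{D_k'},\quad P_2'=(z,x_{k+1},\ldots,x_n, y_{k+1},\ldots,y_n) + I_{D_k},$$ $$P_3=(x_1,\ldots,x_n,y_1,\ldots,y_k),\quad P_3'=(y_1,\ldots,y_n,x_{k+1},\ldots,x_n).$$
   Context: For a finite lattice $L$ and a field $K$, $K[L]$ is the polynomial ring over $K$ whose variables are the elements of $L$, and the join-meet ideal is $I_L=(ab-(a\wedge b)(a\vee b): a,b\in L \text{ incomparable})\subset K[L]$. Let $D$ be the distributive lattice with $2n$ elements $x_1,\dots,x_n,y_1,\dots,y_n$ ordered by: $x_i\le x_j$ iff $i\le j$; $y_i\le y_j$ iff $i\le j$; $x_i\le y_j$ iff $i\le j$; and never $y_i\le x_j$. For $1\le k\le n-1$, $L_k=D\cup\{z\}$ is the lattice obtained from $D$ by adding one new element $z$ with $x_i<z$ exactly for $i\le k$ and $z<y_j$ exactly for $j\ge k+1$, and $z$ incomparable to all other elements (namely $x_j$ for $j\ge k+1$ and $y_i$ for $i\le k$). $D_k$ denotes the sublattice of $D$ with elements $x_i,y_i$, $1\le i\le k$, and $D_k'$ the sublattice of $D$ with elements $x_i,y_i$, $k+1\le i\le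 n$. The ideals $I_{D_k}$ and $I_{D_k'}$ are regarded as extended to $K[L_k]$. For an ideal $J$ and polynomials $f,g$, $(J,f,g)$ denotes the ideal $J+(f,g)$. *)

(* Defs.v *)
From HB Require Import structures.
From mathcomp Require Import all_boot all_order all_algebra ring_quotient.
From mathcomp Require Import boolp classical_sets.
From mathcomp Require Import mpoly.

Set Implicit Arguments.
Unset Strict Implicit.
Unset Printing Implicit Defensive.

Import Order.TTheory GRing.Theory.

Local Open Scope classical_set_scope.
Local Open Scope ring_scope.

(* Ideals are [set R], hence not assumed to be decidable. *)

Definition ideal_gen (R : comNzRingType) (G : set R) : set R :=
  [set f | exists (m : nat) (c g : 'I_m -> R),
     (forall i, G (g i)) /\ f = \sum_(i < m) c i * g i].

Definition ideal_add (R : comNzRingType) (I J : set R) : set R :=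
  [set f + g | f in I & g in J].

(* [idealr_closed] includes properness: it requires 1 not to belong to Q. *)
Definition prime_ideal (R : comNzRingType) (Q : set R) : Prop :=
  idealr_closed (fun f => f \in Q) /\ prime_idealr_closed (fun f => f \in Q).

Definition minimal_primes (R : comNzRingType) (I : set R) : set (set R) :=
  [set Q | [/\ prime_ideal Q, I `<=` Q &
     forall Q', prime_ideal Q' -> I `<=` Q' -> Q' `<=` Q -> Q' = Q]].

(* K[L] is {mpoly K[#|L|]}, the variables being numbered by [enum_rank]. *)
Definition lvar (K : fieldType) d (L : finLatticeType d) (a : L) :
  {mpoly K[#|L|]} := 'X_(enum_rank a).

Definition join_meet_binomial (K : fieldType) d (L : finLatticeType d)
    (a b : L) : {mpoly K[#|L|]} :=
  lvar K a * lvar K b - lvar K (Order.meet a b) * lvar K (Order.join a b).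

Definition join_meet_ideal (K : fieldType) d (L : finLatticeType d) :
    set {mpoly K[#|L|]} :=
  ideal_gen [set f | exists a b : L,
    (a >< b)%O /\ f = join_meet_binomial K a b].

(* For a sublattice S of L, the extension to K[L] of the join-meet ideal of S
   is generated by the binomials of S, whose meets and joins are those of L. *)
Definition sub_join_meet_ideal (K : fieldType) d (L : finLatticeType d)
    (S : latticeClosed L) : set {mpoly K[#|L|]} :=
  ideal_gen [set f | exists a b : L,
    [/\ a \in S, b \in S, (a >< b)%O & f = join_meet_binomial K a b]].

Arguments join_meet_ideal K {d} L.
Arguments sub_join_meet_ideal K {d L} S.

(* Indices are shifted by one: the mathematical x_i and y_i, for 1 <= i <= n,
   are (false, i - 1) and (true, i - 1) in the product lattice bool *p 'I_n. *)
Definition D (n : nat) : finDistrLatticeType _ := bool *p 'I_n.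

Lemma leD_E n (i j : 'I_n) :
  [/\ ((false, i) <= (false, j) :> D n)%O = (i <= j)%N,
      ((true, i) <= (true, j) :> D n)%O = (i <= j)%N,
      ((false, i) <= (true, j) :> D n)%O = (i <= j)%N &
      ((true, i) <= (false, j) :> D n)%O = false].
Proof. by []. Qed.

(* [None] is the new element z. The bounds on k are part of the type because
   the order below is not a lattice without them. *)
Definition Lk (n k : nat) (hk : (0 < k < n)%N) : Type := option (D n).

HB.instance Definition _ n k (hk : (0 < k < n)%N) :=
  Finite.copy (Lk hk) (option (D n)).

Section Lattice.
Context (n k : nat) (hk : (0 < k < n)%N).

Lemma ltn_idx_k : (k.-1 < n)%N.
Proof. by case/andP: hk => _; apply/leq_trans; rewrite ltnS leq_pred. Qed.

Lemma ltn_idx_k1 : (k < n)%N.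
Proof. by case/andP: hk. Qed.

(* The positions of the mathematical indices k and k + 1. *)
Definition idx_k : 'I_n := Ordinal ltn_idx_k.
Definition idx_k1 : 'I_n := Ordinal ltn_idx_k1.

Definition lx (i : 'I_n) : Lk hk := Some (false, i).
Definition ly (i : 'I_n) : Lk hk := Some (true, i).
Definition lz : Lk hk := None.

Definition le_Lk (a b : Lk hk) : bool :=
  match a, b with
  | Some a, Some b => (a <= b)%O
  | Some a, None => ~~ a.1 && (a.2 < k)%N
  | None, Some b => b.1 && (k <= b.2)%N
  | None, None => true
  end.

(* An element of D lies below z iff it lies below x_k, and above z iff it lies
   above y_{k+1}; hence meets and joins with z of elements incomparable to z. *)
Definition meet_Lk (a b : Lk hk) : Lk hk :=
  match a, b with
  | Some a, Some b => Some (Order.meet a b)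
  | Some a, None | None, Some a =>
      if le_Lk lz (Some a) then lz
      else Some (Order.meet a ((false, idx_k) : D n))
  | None, None => lz
  end.

Definition join_Lk (a b : Lk hk) : Lk hk :=
  match a, b with
  | Some a, Some b => Some (Order.join a b)
  | Some a, None | None, Some a =>
      if le_Lk (Some a) lz then lz
      else Some (Order.join a ((true, idx_k1) : D n))
  | None, None => lz
  end.

Lemma le_Lk_z (a : D n) :
  le_Lk (Some a) None = (a <= ((false, idx_k) : D n))%O.
Proof.
case: a => [[] i] //=; rewrite -[RHS]/(i <= k.-1)%N.
by case/andP: hk => k0 _; rewrite -[in LHS](prednK k0) ltnS.
Qed.

Lemma le_z_Lk (a : D n) :
  le_Lk None (Some a) = (((true, idx_k1) : D n) <= a)%O.
Proof. by case: a => [[] i]. Qed.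

Lemma zcutF (a b : D n) :
  (a <= ((false, idx_k) : D n))%O -> (((true, idx_k1) : D n) <= b)%O ->
  (a <= b)%O.
Proof.
move=> ha hb; apply: le_trans ha (le_trans _ hb).
exact: (leq_pred k : ((false, idx_k) <= (true, idx_k1) :> D n)%O).
Qed.

Lemma zcutN (a b : D n) :
  (((true, idx_k1) : D n) <= a)%O -> (a <= b)%O ->
  (b <= ((false, idx_k) : D n))%O -> False.
Proof. by move=> h1 h2 h3; have := le_trans h1 (le_trans h2 h3). Qed.

Lemma le_Lk_refl : reflexive le_Lk.
Proof. by case=> [a|] //; exact: (lexx (a : D n)). Qed.

Lemma le_Lk_anti : antisymmetric le_Lk.
Proof.
case=> [a|] [b|] //.
- by move=> h; congr Some; apply: (@le_anti _ (D n)); exact: h.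
- rewrite !le_Lk_z !le_z_Lk => /andP[h1 h2].
  by case: (zcutN h2 (lexx a) h1).
- rewrite !le_Lk_z !le_z_Lk => /andP[h1 h2].
  by case: (zcutN h1 (lexx b) h2).
Qed.

Lemma le_Lk_trans : transitive le_Lk.
Proof.
case=> [b|] [a|] [c|] //.
- exact: (@le_trans _ (D n)).
- rewrite ?le_Lk_z ?le_z_Lk; exact: (@le_trans _ (D n)).
- rewrite ?le_Lk_z ?le_z_Lk; exact: (@le_trans _ (D n)).
- rewrite !le_Lk_z !le_z_Lk; exact: zcutF.
Qed.

Lemma meet_LkP (a b c : Lk hk) :
  le_Lk a (meet_Lk b c) = le_Lk a b && le_Lk a c.
Proof.
have meetz (x : Lk hk) (y : D n) :
  le_Lk x (if le_Lk None (Some y) then None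
    else Some (Order.meet y ((false, idx_k) : D n)))
  = le_Lk x (Some y) && le_Lk x None.
  case: ifP => zy.
    have [xz|] := boolP (le_Lk x None); last by rewrite andbF.
    by rewrite (le_Lk_trans xz zy).
  case: x => [x|]; last by rewrite zy; case: (y) => [[] ?].
  by rewrite !le_Lk_z; exact: (lexI (x : D n) y (false, idx_k)).
case: b => [b|]; case: c => [c|].
- case: a => [a|]; first exact: (@lexI _ (D n)).
  by rewrite /meet_Lk !le_z_Lk lexI.
- exact: meetz.
- by rewrite andbC; exact: meetz.
- by rewrite andbb.
Qed.

Lemma join_LkP (a b c : Lk hk) :
  le_Lk (join_Lk a b) c = le_Lk a c && le_Lk b c.
Proof.
have joinz (x : Lk hk) (y : D n) :
  le_Lk (if le_Lk (Some y) None then None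
    else Some (Order.join y ((true, idx_k1) : D n))) x
  = le_Lk (Some y) x && le_Lk None x.
  case: ifP => yz.
    have [zx|] := boolP (le_Lk None x); last by rewrite andbF.
    by rewrite (le_Lk_trans yz zx).
  case: x => [x|]; last by rewrite yz; case: (y) => [[] ?].
  by rewrite !le_z_Lk; exact: (leUx (y : D n) (true, idx_k1) x).
case: a => [a|]; case: b => [b|].
- case: c => [c|]; first exact: (@leUx _ (D n)).
  by rewrite /join_Lk !le_Lk_z leUx.
- exact: joinz.
- by rewrite andbC; exact: joinz.
- by rewrite andbb.
Qed.

End Lattice.

Fact Lk_display : Order.disp_t. Proof. exact: Order.Disp tt tt. Qed.

HB.instance Definition _ n k (hk : (0 < k < n)%N) :=
  Order.Le_isPOrder.Build Lk_display (Lk hk)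
    (@le_Lk_refl n k hk) (@le_Lk_anti n k hk) (@le_Lk_trans n k hk).

HB.instance Definition _ n k (hk : (0 < k < n)%N) :=
  Order.POrder_MeetJoin_isLattice.Build Lk_display (Lk hk)
    (@meet_LkP n k hk) (@join_LkP n k hk).

Definition in_Dk n k (hk : (0 < k < n)%N) : pred (Lk hk) :=
  fun a => if a is Some p then (p.2 < k)%N else false.

Definition in_Dk' n k (hk : (0 < k < n)%N) : pred (Lk hk) :=
  fun a => if a is Some p then (k <= p.2)%N else false.

Lemma meetI2 n (a b : D n) :
  (Order.meet a b).2 = a.2 \/ (Order.meet a b).2 = b.2.
Proof.
rewrite -[(Order.meet a b).2]/(Order.meet a.2 b.2).
by case: (leP a.2 b.2); [left | right].
Qed.

Lemma joinU2 n (a b : D n) :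
  (Order.join a b).2 = a.2 \/ (Order.join a b).2 = b.2.
Proof.
rewrite -[(Order.join a b).2]/(Order.join a.2 b.2).
by case: (leP a.2 b.2); [right | left].
Qed.

Lemma Dk_meet n k (hk : (0 < k < n)%N) :
  {in @in_Dk n k hk &, forall a b, Order.meet a b \in @in_Dk n k hk}.
Proof.
move=> [a|] [b|] // ha hb; change ((Order.meet a b).2 < k)%N.
by case: (meetI2 a b) => ->.
Qed.

Lemma Dk_join n k (hk : (0 < k < n)%N) :
  {in @in_Dk n k hk &, forall a b, Order.join a b \in @in_Dk n k hk}.
Proof.
move=> [a|] [b|] // ha hb; change ((Order.join a b).2 < k)%N.
by case: (joinU2 a b) => ->.
Qed.

Lemma Dk'_meet n k (hk : (0 < k < n)%N) :
  {in @in_Dk' n k hk &, forall a b, Order.meet a b \in @in_Dk' n k hk}.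
Proof.
move=> [a|] [b|] // ha hb; change (k <= (Order.meet a b).2)%N.
by case: (meetI2 a b) => ->.
Qed.

Lemma Dk'_join n k (hk : (0 < k < n)%N) :
  {in @in_Dk' n k hk &, forall a b, Order.join a b \in @in_Dk' n k hk}.
Proof.
move=> [a|] [b|] // ha hb; change (k <= (Order.join a b).2)%N.
by case: (joinU2 a b) => ->.
Qed.

HB.instance Definition _ n k (hk : (0 < k < n)%N) :=
  Order.isLatticeClosed.Build Lk_display (Lk hk) (@in_Dk n k hk)
    (@Dk_meet n k hk) (@Dk_join n k hk).

HB.instance Definition _ n k (hk : (0 < k < n)%N) :=
  Order.isLatticeClosed.Build Lk_display (Lk hk) (@in_Dk' n k hk)
    (@Dk'_meet n k hk) (@Dk'_join n k hk).

Definition Dk n k (hk : (0 < k < n)%N) : latticeClosed (Lk hk) :=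
  Order.LatticeClosed.clone _ _ (@in_Dk n k hk) _.

Definition Dk' n k (hk : (0 < k < n)%N) : latticeClosed (Lk hk) :=
  Order.LatticeClosed.clone _ _ (@in_Dk' n k hk) _.

(* Main.v *)
Require Import Defs.
From HB Require Import structures.
From mathcomp Require Import all_boot all_order all_algebra.
From mathcomp Require Import boolp classical_sets.
From mathcomp Require Import mpoly ring.

(** Write I for the join-meet ideal.  It is generated by the 2-minors
    x_j y_i - x_i y_j of the 2 x n matrix with rows x and y, together with
    z x_j - x_k y_j for j > k and z y_i - x_i y_(k+1) for i <= k.  Indices in
    the comments start at 1, so that i in the code stands for i + 1.

    Every prime Q over I contains one of the seven ideals ([prime_cover]).
    Subtracting minors from the last two families shows that I contains
    x_j (z - y_k) for j > k and y_i (z - x_(k+1)) for i <= k.  So Q contains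
    all x_j with j > k or z - y_k, and it contains all y_i with i <= k or
    z - x_(k+1).  If it contains both differences, it contains P.  Otherwise
    the minors put every product x_i y_j with i <= k < j into Q, hence all x_i
    with i <= k or all y_j with j > k; the two alternatives in each of the
    three remaining cases give the other six ideals.

    Each of the seven ideals is the kernel of a morphism into a domain.  The
    substitution x_i -> a_i, y_i -> v a_i has the ideal of all minors as its
    kernel ([torL0_kernel]).  In P one has z = x_(k+1) = y_k, so P is the ideal
    of a rational normal scroll in which columns k and k + 1 form one block
    (x_k, y_k, y_(k+1)) of powers 1, v, v^2; the substitution is the same with
    a_(k+1) = v a_k and z -> v a_k ([idealP_kernel]).  In both cases the
    kernel of a monomial map is spanned by differences of monomials with equal
    image, and any two such monomials are joined by exchanging v-exponents
    between two variables at a time ([fiber_cong], [toric_kernel]); each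
    exchange is a minor, in P up to z = x_(k+1) = y_k.  The other six ideals
    kill a set of variables that is constant on the blocks low x, high x, low y,
    high y, z, and keep the minors in the surviving variables: they are kernels
    of the first substitution composed with the one that sends the killed
    variables to 0 ([dead_ideal_prime]).

    No two of the seven are comparable.  The six are told apart by the
    variables that they contain, P contains no variable, and none of the six
    contains both z - x_(k+1) and z - y_k. *)

Set Implicit Arguments.
Unset Strict Implicit.
Unset Printing Implicit Defensive.

Import Order.TTheory GRing.Theory.

Local Open Scope classical_set_scope.
Local Open Scope ring_scope.

(** * Ideals and their minimal primes *)

(** Unlike [idealr_closed], this allows the unit ideal. *)
Definition is_ideal (R : comNzRingType) (J : set R) : Prop :=
  [/\ J 0, forall f g, J f -> J g -> J (f + g) & forall c f, J f -> J (c * f)].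

Section Ideals.
Context (R : comNzRingType).
Implicit Types (G H J : set R).

Lemma ideal_sum J (I : Type) (r : seq I) (p : pred I) (F : I -> R) :
  is_ideal J -> (forall i, p i -> J (F i)) -> J (\sum_(i <- r | p i) F i).
Proof. by case=> J0 JD _ hF; elim/big_ind: _. Qed.

Lemma idealN J f : is_ideal J -> J f -> J (- f).
Proof. by case=> _ _ JM /(JM (-1)); rewrite mulN1r. Qed.

Lemma idealMr J f c : is_ideal J -> J f -> J (f * c).
Proof. by case=> _ _ JM /(JM c); rewrite mulrC. Qed.

Lemma idealB J f g : is_ideal J -> J f -> J g -> J (f - g).
Proof. by move=> Ji Jf /(idealN Ji); case: Ji => _ JD _; exact: JD. Qed.

Lemma ideal_subC J f g : is_ideal J -> J (f - g) -> J (g - f).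
Proof. by move=> Ji /(idealN Ji); rewrite opprB. Qed.

Lemma ideal_sub_trans J g f h :
  is_ideal J -> J (f - g) -> J (g - h) -> J (f - h).
Proof.
by case=> _ JD _ fg gh; rewrite -(subrKA g); apply: JD.
Qed.

Lemma ideal_subM J f f' g g' :
  is_ideal J -> J (f - f') -> J (g - g') -> J (f * g - f' * g').
Proof.
move=> Ji ff' gg'; apply: (@ideal_sub_trans _ (f' * g)) => //.
  by rewrite -mulrBl; apply: idealMr.
by rewrite -mulrBr; case: Ji => _ _; apply.
Qed.

Lemma ideal_gen_ideal G : is_ideal (ideal_gen G).
Proof.
split.
- exists 0%N, (fun=> 0), (fun=> 0); split; first by case.
  by rewrite big_ord0.
- move=> _ _ [m [c [g [Gg ->]]]] [m' [c' [g' [Gg' ->]]]].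
  pose glue T (u : 'I_m -> T) (u' : 'I_m' -> T) (i : 'I_(m + m')) :=
    match split i with inl j => u j | inr j => u' j end.
  exists (m + m')%N, (glue _ c c'), (glue _ g g'); split.
    by rewrite /glue => i; case: split.
  rewrite big_split_ord /glue; congr (_ + _); apply: eq_bigr => i _.
    by rewrite (unsplitK (inl i)).
  by rewrite (unsplitK (inr i)).
- move=> a _ [m [c [g [Gg ->]]]]; exists m, (fun i => a * c i), g; split=> //.
  by rewrite mulr_sumr; apply: eq_bigr => i _; rewrite mulrA.
Qed.

Lemma sub_ideal_gen G : G `<=` ideal_gen G.
Proof.
move=> f Gf; exists 1%N, (fun=> 1), (fun=> f); split=> //.
by rewrite big_ord1 mul1r.
Qed.

Lemma ideal_gen_sub G J : is_ideal J -> G `<=` J -> ideal_gen G `<=` J.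
Proof.
move=> Ji GJ _ [m [c [g [Gg ->]]]]; apply: ideal_sum => // i _.
by case: Ji => _ _ JM; apply: JM; apply: GJ.
Qed.

Lemma ideal_add_gen G H :
  ideal_add (ideal_gen G) (ideal_gen H) = ideal_gen (G `|` H).
Proof.
have GHi := ideal_gen_ideal (G `|` H).
apply/seteqP; split.
  move=> _ [f Gf [g Hg <-]]; case: (GHi) => _ GHD _; apply: GHD.
    by apply: ideal_gen_sub Gf => // u Gu; apply: sub_ideal_gen; left.
  by apply: ideal_gen_sub Hg => // u Hu; apply: sub_ideal_gen; right.
have [G0 GD GM] := ideal_gen_ideal G; have [H0 HD HM] := ideal_gen_ideal H.
apply: ideal_gen_sub.
  split; first by exists 0 => //; exists 0 => //; rewrite addr0.
    move=> _ _ [f Gf [g Hg <-]] [f' Gf' [g' Hg' <-]].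
    exists (f + f'); first exact: GD.
    by exists (g + g'); [exact: HD | rewrite addrACA].
  move=> c _ [f Gf [g Hg <-]]; exists (c * f); first exact: GM.
  by exists (c * g); [exact: HM | rewrite mulrDr].
move=> f [Gf|Hf].
  by exists f; [exact: sub_ideal_gen | exists 0 => //; rewrite addr0].
by exists 0 => //; exists f; [exact: sub_ideal_gen | rewrite add0r].
Qed.

Lemma prime_idealE J : prime_ideal J ->
  is_ideal J /\ (forall f g, J (f * g) -> J f \/ J g).
Proof.
move=> [[J0 _ JL] JM]; split; first split.
- by apply: set_mem.
- move=> f g /mem_set Jf /mem_set Jg; rewrite -[f]mul1r; apply: set_mem.
  exact: JL.
- move=> c f /mem_set Jf; rewrite -[_ * _]addr0; apply: set_mem; exact: JL.
- by move=> f g /mem_set /JM /orP[] /set_mem; [left | right].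
Qed.

Lemma kernel_prime (S : idomainType) (phi : {rmorphism R -> S}) J :
  (forall f, J f <-> phi f = 0) -> prime_ideal J.
Proof.
move=> JE; have memJ f : (f \in J) = (phi f == 0).
  by apply/idP/eqP => [/set_mem /JE | /JE /mem_set].
split; first split; rewrite ?memJ ?rmorph0 ?rmorph1 ?oner_eq0 //.
  move=> a f g; rewrite !memJ => /eqP f0 /eqP g0.
  by rewrite rmorphD rmorphM f0 g0 mulr0 addr0.
by move=> f g; rewrite !memJ rmorphM mulf_eq0.
Qed.

Lemma kernel_ideal (S : idomainType) (phi : {rmorphism R -> S}) :
  is_ideal [set f | phi f = 0].
Proof.
split=> /= [|f g f0 g0|c f f0]; first exact: rmorph0.
  by rewrite rmorphD f0 g0 addr0.
by rewrite rmorphM f0 mulr0.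
Qed.

(** A family of primes over J whose members lie below every prime over J, and
    are pairwise incomparable, is the set of minimal primes. *)
Lemma minimal_primesP J (A : set (set R)) :
  (forall Q, A Q -> prime_ideal Q /\ J `<=` Q) ->
  (forall Q, prime_ideal Q -> J `<=` Q -> exists2 Q', A Q' & Q' `<=` Q) ->
  (forall Q Q', A Q -> A Q' -> Q `<=` Q' -> Q = Q') ->
  minimal_primes J = A.
Proof.
move=> Aprime Acover Aanti; apply/seteqP; split=> Q.
  move=> [Qp JQ Qmin]; have [Q' AQ' Q'Q] := Acover Q Qp JQ.
  by have [Q'p JQ'] := Aprime _ AQ'; rewrite -(Qmin Q').
move=> AQ; have [Qp JQ] := Aprime _ AQ; split=> // Q' Q'p JQ' Q'Q.
have [Q'' AQ'' Q''Q'] := Acover _ Q'p JQ'.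
have QE : Q'' = Q by apply: Aanti => //; exact: subset_trans Q'Q.
by apply/seteqP; split=> //; rewrite -QE.
Qed.

End Ideals.

(** * Monomials with the same image under a monomial map *)

(** Each index t stands for a variable X t mapped to v ^ e t * a_(cls t), and a
    product of variables is a sequence of indices.  The hypothesis exch trades
    one power of v between two factors modulo J. *)
Section Fibers.
Context (R : comNzRingType) (T C : eqType) (J : set R) (X : T -> R).
Context (cls : T -> C) (e : T -> nat).
Context (Ji : is_ideal J).
Context (same : forall t t', cls t = cls t' -> e t = e t' -> J (X t - X t')).
Context (exch : forall t t' s,
  cls t = cls t' -> (e t < e t')%N -> (0 < e s)%N ->
  exists t1 s1, [/\ cls t1 = cls t, e t1 = (e t).+1, cls s1 = cls s,
    e s = (e s1).+1 & J (X t * X s - X t1 * X s1)]).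

(** As long as e t is below e t', some other factor has a positive exponent from
    which a unit can be moved to t. *)
Lemma raise_head t t' r : cls t = cls t' -> (e t <= e t')%N ->
    (e t' <= e t + \sum_(s <- r) e s)%N ->
  exists r', [/\ map cls r' = map cls r,
    (e t + \sum_(s <- r) e s = e t' + \sum_(s <- r') e s)%N &
    J (X t * \prod_(s <- r) X s - X t' * \prod_(s <- r') X s)].
Proof.
move=> ct; have [d dE] := ubnP (e t' - e t)%N.
elim: d t r ct dE => // d IHd t r ct dE le_tt' le_t'r.
have := le_tt'; rewrite leq_eqVlt => /predU1P[et|lt_tt'].
  exists r; split; rewrite ?et //; apply: ideal_subM => //; first exact: same.
  by rewrite subrr; case: Ji.
have /hasP[s sr es] : has (fun s => 0 < e s)%N r.
  apply: contraTT le_t'r => /hasPn r0; rewrite big_seq big1 ?addn0 -?ltnNge //.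
  by move=> s /r0; case: (e s).
have [t1 [s1 [ct1 et1 cs1 es1 Jexch]]] := exch ct lt_tt' es.
case/splitPr: sr le_t'r => r1 r2 le_t'r.
have sumE (s' : T) : \sum_(u <- r1 ++ s' :: r2) e u =
    (e s' + \sum_(u <- r1 ++ r2) e u)%N.
  by rewrite !big_cat big_cons /= addnCA.
have prodE (s' : T) : \prod_(u <- r1 ++ s' :: r2) X u =
    X s' * \prod_(u <- r1 ++ r2) X u.
  by rewrite !big_cat big_cons /= mulrCA.
have sumE1 : (e t1 + \sum_(u <- r1 ++ s1 :: r2) e u =
    e t + \sum_(u <- r1 ++ s :: r2) e u)%N.
  by rewrite !sumE et1 es1 addSnnS addSn.
have [||||r' [cr' er' Jr']] := IHd t1 (r1 ++ s1 :: r2).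
- by rewrite ct1.
- by rewrite et1 -ltnS -(subSn lt_tt') subSS.
- by rewrite et1.
- by rewrite sumE1.
exists r'; split; first by rewrite cr' !map_cat /= cs1.
  by rewrite -er' sumE1.
apply: ideal_sub_trans Jr' => //; rewrite !prodE !mulrA.
by apply: ideal_subM => //; rewrite subrr; case: Ji.
Qed.

(** This aligns the factors of two monomials of equal multidegree. *)
Lemma perm_map_lift r r' : perm_eq (map cls r) (map cls r') ->
  exists2 r'', perm_eq r' r'' & map cls r = map cls r''.
Proof.
elim: r r' => [|t r IHr] r' /=.
  by move/perm_size; case: r' => // _; exists [::].
move=> tr; have /mapP[t' t'r' ct] : cls t \in map cls r'.
  by rewrite -(perm_mem tr) mem_head.
have r'E := perm_to_rem t'r'.
have [|r'' r''P cr] := IHr (rem t' r').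
  rewrite -(perm_cons (cls t)); apply: perm_trans tr _.
  by rewrite ct; exact: (perm_map cls r'E).
exists (t' :: r''); last by rewrite /= ct cr.
by apply: perm_trans r'E _; rewrite perm_cons.
Qed.

(** Comparing first factors, raise the one of smaller exponent to the other and
    cancel it; what is left still has equal images. *)
Lemma fiber_cong r r' : perm_eq (map cls r) (map cls r') ->
  (\sum_(s <- r) e s = \sum_(s <- r') e s)%N ->
  J (\prod_(s <- r) X s - \prod_(s <- r') X s).
Proof.
move=> /perm_map_lift[r'' r'r'' cr].
rewrite (perm_big _ r'r'') [in X in J X](perm_big _ r'r'') /= {r' r'r''}.
move: {2}(size r) (leqnn (size r)) => m.
elim: m r r'' cr => [|m IHm] r r'.
  by case: r r' => [|//] [|//]; rewrite !big_nil subrr; case: Ji.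
case: r r' => [|t r] [|t' r'] //=.
  by rewrite !big_nil subrr; case: Ji.
wlog le_tt' : t t' r r' / (e t <= e t')%N => [W|].
  have [|lt_t't] := leqP (e t) (e t'); first exact: W.
  move=> cr sz er; apply: ideal_subC => //; apply: W => //; first exact: ltnW.
  by case: cr => _ /(congr1 size); rewrite !size_map => <-.
move=> [ct cr] sz; rewrite !big_cons => er.
have [|r2 [cr2 er2 Jr2]] := raise_head ct le_tt' (r := r).
  by rewrite er leq_addr.
apply: ideal_sub_trans Jr2 _ => //.
apply: ideal_subM => //; first by rewrite subrr; case: Ji.
apply: IHm; first by rewrite cr2.
  by rewrite -(size_map cls) cr2 size_map.
by apply/eqP; rewrite -(eqn_add2l (e t')) -er2 er.
Qed.

End Fibers.

(** * Kernels of monomial maps *)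

Section Toric.
Context (K : fieldType) (N : nat).
Implicit Types (f : {mpoly K[N]}) (m : 'X_{1..N}).

(** If w m is the image of the monomial m under a monomial map, the sum over the
    fiber of o is the coefficient of o in the image of f.  Replacing every
    monomial by one representative of its fiber changes f by an element of J and
    leaves these sums as coefficients. *)
Lemma fiber_sum_zero (W : choiceType) (w : 'X_{1..N} -> W)
    (J : set {mpoly K[N]}) f :
  is_ideal J ->
  (forall m m', w m = w m' -> J ('X_[m] - 'X_[m'])) ->
  (forall o, \sum_(m <- msupp f | w m == o) f@_m = 0) -> J f.
Proof.
move=> Ji Jw f0; pose s o := xget 0%MM [set m | w m = o].
have ws m : w (s (w m)) = w m.
  by apply: (@xgetPex _ 0%MM [set m' | w m' = w m]); exists m.
have -> : f = \sum_(m <- msupp f) f@_m *: ('X_[m] - 'X_[s (w m)])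
   + \sum_(m <- msupp f) f@_m *: 'X_[s (w m)].
  rewrite -big_split /= {1}[f]mpolyE; apply: eq_bigr => m _.
  by rewrite scalerBr subrK.
rewrite [X in _ + X](_ : _ = 0) ?addr0; last first.
  pose W' := undup (map w (msupp f)).
  transitivity
    (\sum_(o <- W') \sum_(m <- msupp f | w m == o) f@_m *: 'X_[K, s o]).
    rewrite [RHS](exchange_big_dep xpredT) //= big_seq [RHS]big_seq.
    apply: eq_bigr => m mf; rewrite -big_filter.
    rewrite (_ : [seq o <- W' | w m == o] = [:: w m]) ?big_seq1 //.
    rewrite (eq_filter (a2 := pred1 (w m))) => [|o]; last by rewrite eq_sym.
    by rewrite filter_pred1_uniq ?undup_uniq // mem_undup map_f.
  by rewrite big1 // => o _; rewrite -scaler_suml f0 scale0r.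
apply: ideal_sum => // m _; rewrite -mul_mpolyC.
by case: Ji => _ _; apply; apply: Jw; rewrite ws.
Qed.

(** The variable of the outer polynomial ring is v. *)
Definition toric (cls : 'I_N -> 'I_N) (e : 'I_N -> nat) :
    {mpoly K[N]} -> {poly {mpoly K[N]}} :=
  mmap (polyC \o @mpolyC N K) (fun i => 'X^(e i) * ('X_(cls i))%:P).
HB.instance Definition _ cls e := GRing.RMorphism.copy (toric cls e)
  (mmap (polyC \o @mpolyC N K) (fun i => 'X^(e i) * ('X_(cls i))%:P)).

Lemma toric_kernel cls e (J : set {mpoly K[N]}) f :
  is_ideal J ->
  (forall t t', cls t = cls t' -> e t = e t' -> J ('X_t - 'X_t')) ->
  (forall t t' s, cls t = cls t' -> (e t < e t')%N -> (0 < e s)%N ->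
    exists t1 s1, [/\ cls t1 = cls t, e t1 = (e t).+1, cls s1 = cls s,
      e s = (e s1).+1 & J ('X_t * 'X_s - 'X_t1 * 'X_s1)]) ->
  toric cls e f = 0 -> J f.
Proof.
move=> Ji Jsame Jexch f0.
pose word m := flatten [seq nseq (m i) i | i <- enum 'I_N].
have wordE m : 'X_[m] = \prod_(i <- word m) 'X_i :> {mpoly K[N]}.
  rewrite big_flatten big_map big_enum mpolyXE_id; apply: eq_bigr => i _.
  by rewrite big_nseq iter_mulr_1.
pose w m : nat * 'X_{1..N} :=
  ((\sum_(i <- word m) e i)%N, (\sum_(i <- word m) U_(cls i))%MM).
have toricX m : toric cls e 'X_[m] = 'X^((w m).1) * ('X_[(w m).2])%:P.
  rewrite wordE rmorph_prod -mprodXE rmorph_prod expr_sum -big_split /=.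
  by apply: eq_bigr => i _; rewrite /toric mmapX mmap1U.
apply: (fiber_sum_zero (w := w)) => //.
  move=> m m' /pair_eqP /andP[/= /eqP we /eqP wc].
  rewrite !wordE; apply: (fiber_cong (cls := cls) (e := e)) => //.
  have count_cls r i : (\sum_(t <- r) U_(cls t))%MM i = count_mem i (map cls r).
    rewrite mnm_sumE -sum1_count big_map [RHS]big_mkcond /=.
    by apply: eq_bigr => t _; rewrite mnm1E; case: eqP.
  by apply/allP => i _ /=; rewrite -!count_cls wc.
move=> [j mu]; transitivity ((toric cls e f)`_j)@_mu; last first.
  by rewrite f0 coef0 mcoeff0.
have -> : toric cls e f =
    \sum_(m <- msupp f) ((f@_m)%:MP)%:P * ('X^((w m).1) * ('X_[(w m).2])%:P).
  by apply: eq_bigr => m _; rewrite -toricX [RHS]/= /toric mmapX.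
rewrite coef_sum raddf_sum big_mkcond; apply: eq_bigr => m _.
case: (w m) => a b /=; rewrite coefCM coefMC coefXn mcoeffCM.
rewrite xpair_eqE [j == a]eq_sym; case: eqP => _ /=; last first.
  by rewrite mul0r mcoeff0 mulr0.
by rewrite mul1r mcoeffX; case: eqP => _; rewrite ?mulr1 ?mulr0.
Qed.
End Toric.

(** * Substitutions for the variables of a lattice *)

Section LatticeVariables.
Context (K : fieldType) d (L : finLatticeType d).
Implicit Types (S : pred L) (t : L).
Local Notation KL := {mpoly K[#|L|]}.

Definition torL (cls : L -> L) (e : L -> nat) : KL -> {poly KL} :=
  toric (fun i => enum_rank (cls (enum_val i))) (fun i => e (enum_val i)).
HB.instance Definition _ cls e := GRing.RMorphism.copy (torL cls e)
  (toric (fun i => enum_rank (cls (enum_val i))) (fun i => e (enum_val i))).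

Lemma torL_lvar cls e t :
  torL cls e (lvar K t) = 'X^(e t) * (lvar K (cls t))%:P.
Proof. by rewrite /torL /toric mmapX mmap1U enum_rankK. Qed.

Lemma torL_lvar_neq0 cls e t : torL cls e (lvar K t) != 0.
Proof.
rewrite torL_lvar mulf_neq0 ?expf_neq0 ?polyX_eq0 ?polyC_eq0 //.
by rewrite -msupp_eq0 msuppX.
Qed.

Lemma torL_binomial cls e a b c d' :
  (e a + e b = e c + e d')%N ->
  lvar K (cls a) * lvar K (cls b) = lvar K (cls c) * lvar K (cls d') ->
  torL cls e (lvar K a * lvar K b - lvar K c * lvar K d') = 0.
Proof.
have productE u v : torL cls e (lvar K u * lvar K v) =
    'X^(e u + e v) * (lvar K (cls u) * lvar K (cls v))%:P.
  by rewrite rmorphM /= !torL_lvar exprD polyCM mulrACA.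
by move=> eE clsE; rewrite rmorphB /= !productE eE clsE subrr.
Qed.

Lemma torL_difference cls e a b :
  e a = e b -> cls a = cls b -> torL cls e (lvar K a - lvar K b) = 0.
Proof. by move=> eE clsE; rewrite rmorphB /= !torL_lvar eE clsE subrr. Qed.

Lemma torL_kernel cls e (J : set KL) f :
  is_ideal J ->
  (forall t t', cls t = cls t' -> e t = e t' -> J (lvar K t - lvar K t')) ->
  (forall t t' s, cls t = cls t' -> (e t < e t')%N -> (0 < e s)%N ->
    exists t1 s1, [/\ cls t1 = cls t, e t1 = (e t).+1, cls s1 = cls s,
      e s = (e s1).+1 &
      J (lvar K t * lvar K s - lvar K t1 * lvar K s1)]) ->
  torL cls e f = 0 -> J f.
Proof.
move=> Ji Jsame Jexch; apply: toric_kernel => // [t t' /enum_rank_inj ct et|].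
  by have := Jsame _ _ ct et; rewrite /lvar !enum_valK.
move=> t t' s /enum_rank_inj ct lt_tt' s0.
have [t1 [s1 [ct1 et1 cs1 es1 J1]]] := Jexch _ _ _ ct lt_tt' s0.
exists (enum_rank t1), (enum_rank s1); rewrite !enum_rankK ct1 cs1; split=> //.
by move: J1; rewrite /lvar !enum_valK.
Qed.

Definition kill S : KL -> KL :=
  mmap (@mpolyC _ K) (fun i => if S (enum_val i) then 0 else 'X_i).
HB.instance Definition _ S := GRing.RMorphism.copy (kill S)
  (mmap (@mpolyC _ K) (fun i => if S (enum_val i) then 0 else 'X_i)).

Lemma kill_lvar S t : kill S (lvar K t) = if S t then 0 else lvar K t.
Proof. by rewrite /kill mmapX mmap1U enum_rankK. Qed.

Lemma kill_binomial S a b c d' : ~~ S a -> ~~ S b -> ~~ S c -> ~~ S d' ->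
  kill S (lvar K a * lvar K b - lvar K c * lvar K d') =
  lvar K a * lvar K b - lvar K c * lvar K d'.
Proof.
have killE t : ~~ S t -> kill S (lvar K t) = lvar K t.
  by rewrite kill_lvar => /negPf->.
by move=> Sa Sb Sc Sd; rewrite rmorphB /= !rmorphM /= !killE.
Qed.

Lemma kill_cong S (J : set KL) f :
  is_ideal J -> (forall t, S t -> J (lvar K t)) -> J (f - kill S f).
Proof.
move=> Ji JS; case: (Ji) => J0 JD JM.
have Jprod m : J ('X_[m] - kill S 'X_[m]).
  rewrite mpolyXE_id rmorph_prod /=.
  elim/big_rec2: _ => [|i a b _ Jab]; first by rewrite subrr.
  apply: ideal_subM => //; rewrite rmorphXn /=.
  elim: (m i) => [|r IHr]; first by rewrite !expr0 subrr.
  rewrite !exprS; apply: ideal_subM => //.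
  have := kill_lvar S (enum_val i); rewrite /lvar enum_valK => ->.
  case: ifP => [/JS|_]; last by rewrite subrr.
  by rewrite /lvar enum_valK subr0.
rewrite {1}[f]mpolyE [in kill _ f](mpolyE f) rmorph_sum -sumrB /=.
apply: ideal_sum => // m _; rewrite -mul_mpolyC rmorphM /=.
by rewrite {1}/kill mmapC -mulrBr; apply: JM.
Qed.

End LatticeVariables.

(** * The generators of the join-meet ideal *)

Section LkPrimes.
Context (K : fieldType) (n k : nat) (hk : (0 < k < n)%N).
Local Notation L := (Lk hk : finLatticeType Lk_display).
Local Notation KL := {mpoly K[#|L|]}.
Local Notation x i := (lvar K (lx hk i)).
Local Notation y i := (lvar K (ly hk i)).
Local Notation z := (lvar K (lz hk)).
Local Notation I := (join_meet_ideal K L).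
Local Notation ik := (idx_k hk).
Local Notation ik1 := (idx_k1 hk).

Lemma Lk_ind (A : L -> Prop) :
  (forall i, A (lx hk i)) -> (forall i, A (ly hk i)) -> A (lz hk) ->
  forall t, A t.
Proof. by move=> Ax Ay Az [[[] i]|]; [exact: Ay | exact: Ax | exact: Az]. Qed.

Lemma incomparable_ind (A : L -> L -> Prop) :
  (forall a b, A a b -> A b a) ->
  (forall i j : 'I_n, (i < j)%N -> A (lx hk j) (ly hk i)) ->
  (forall j : 'I_n, (k <= j)%N -> A (lz hk) (lx hk j)) ->
  (forall i : 'I_n, (i < k)%N -> A (lz hk) (ly hk i)) ->
  forall a b, (a >< b)%O -> A a b.
Proof.
move=> Asym Axy Azx Azy a b; rewrite /Order.comparable negb_or.
elim/Lk_ind: a => [i|i|]; elim/Lk_ind: b => [j|j|] /andP[];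
  rewrite -![(_ <= _)%O]/(le_Lk _ _) /= ?(andbT, andbF) //.
- rewrite -![(_ <= _ :> D n)%O]/(_ <= _)%N -!ltnNge => /ltn_trans h /h.
  by rewrite ltnn.
- by rewrite -![(_ <= _ :> D n)%O]/(_ <= _)%N -ltnNge => /Axy.
- by rewrite -leqNgt => /Azx/Asym.
- by rewrite -![(_ <= _ :> D n)%O]/(_ <= _)%N -ltnNge => _ /Axy/Asym.
- rewrite -![(_ <= _ :> D n)%O]/(_ <= _)%N -!ltnNge => /ltn_trans h /h.
  by rewrite ltnn.
- by rewrite -ltnNge => _ /Azy/Asym.
- by rewrite -leqNgt => _ /Azx.
- by rewrite -ltnNge => /Azy.
Qed.

Lemma incomparable_xy (i j : 'I_n) : (i < j)%N -> (lx hk j >< ly hk i)%O.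
Proof.
move=> ij; rewrite /Order.comparable negb_or -![(_ <= _)%O]/(le_Lk _ _) /=.
by rewrite -![(_ <= _ :> D n)%O]/(_ <= _)%N -ltnNge ij.
Qed.

Lemma incomparable_zx (j : 'I_n) : (k <= j)%N -> (lz hk >< lx hk j)%O.
Proof.
move=> kj; rewrite /Order.comparable negb_or -![(_ <= _)%O]/(le_Lk _ _) /=.
by rewrite -leqNgt.
Qed.

Lemma incomparable_zy (i : 'I_n) : (i < k)%N -> (lz hk >< ly hk i)%O.
Proof.
move=> ik; rewrite /Order.comparable negb_or -![(_ <= _)%O]/(le_Lk _ _) /=.
by rewrite -ltnNge ik.
Qed.

(** The sign is chosen so that for i < j this is the binomial of x_j and y_i. *)
Definition minor (i j : 'I_n) : KL := x j * y i - x i * y j.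

Lemma binomial_xy (i j : 'I_n) : (i < j)%N ->
  join_meet_binomial K (lx hk j) (ly hk i) = minor i j.
Proof.
move=> ij; rewrite /join_meet_binomial /minor.
have -> : Order.meet (lx hk j) (ly hk i) = lx hk i.
  congr (Some (_, _)); exact: (@meet_r _ 'I_n _ _ (ltnW ij)).
have -> // : Order.join (lx hk j) (ly hk i) = ly hk j.
congr (Some (_, _)); exact: (@join_l _ 'I_n _ _ (ltnW ij)).
Qed.

Lemma binomial_zx (j : 'I_n) : (k <= j)%N ->
  join_meet_binomial K (lz hk) (lx hk j) = z * x j - x ik * y j.
Proof.
move=> kj; rewrite /join_meet_binomial.
have -> : Order.meet (lz hk) (lx hk j) = lx hk ik.
  congr (Some (_, _)); apply: (@meet_r _ 'I_n).
  exact: (leq_trans (leq_pred k) kj).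
have -> // : Order.join (lz hk) (lx hk j) = ly hk j.
rewrite -[Order.join _ _]/(join_Lk _ _) /= ltnNge kj /=.
congr (Some (_, _)); exact: (@join_l _ 'I_n).
Qed.

Lemma binomial_zy (i : 'I_n) : (i < k)%N ->
  join_meet_binomial K (lz hk) (ly hk i) = z * y i - x i * y ik1.
Proof.
move=> lt_ik; rewrite /join_meet_binomial.
have -> : Order.meet (lz hk) (ly hk i) = lx hk i.
  rewrite -[Order.meet _ _]/(meet_Lk _ _) /= leqNgt lt_ik /=.
  congr (Some (_, _)); apply: (@meet_l _ 'I_n).
  by rewrite -[(_ <= _)%O]/(i <= k.-1)%N -ltnS prednK //; case/andP: hk.
have -> // : Order.join (lz hk) (ly hk i) = ly hk ik1.
congr (Some (_, _)); apply: (@join_r _ 'I_n); exact: ltnW.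
Qed.

Lemma binomialC (a b : L) : join_meet_binomial K a b = join_meet_binomial K b a.
Proof. by rewrite /join_meet_binomial mulrC meetC joinC. Qed.

Lemma join_meet_ideal_sub (J : set KL) : is_ideal J ->
  (forall i j : 'I_n, (i < j)%N -> J (minor i j)) ->
  (forall j : 'I_n, (k <= j)%N -> J (z * x j - x ik * y j)) ->
  (forall i : 'I_n, (i < k)%N -> J (z * y i - x i * y ik1)) ->
  I `<=` J.
Proof.
move=> Ji Jxy Jzx Jzy; apply: ideal_gen_sub => // _ [a [b [ab ->]]].
elim/incomparable_ind: a b / ab => [a b|i j ij|j kj|i ik].
- by rewrite binomialC.
- by rewrite binomial_xy //; apply: Jxy.
- by rewrite binomial_zx //; apply: Jzx.
- by rewrite binomial_zy //; apply: Jzy.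
Qed.

Lemma minorC i j : minor j i = - minor i j.
Proof. by rewrite /minor opprB. Qed.

Lemma minorii i : minor i i = 0. Proof. exact: subrr. Qed.

Lemma minor_wlog (J : set KL) (A : 'I_n -> 'I_n -> Prop) : is_ideal J ->
  (forall i j, A i j -> A j i) ->
  (forall i j : 'I_n, (i < j)%N -> A i j -> J (minor i j)) ->
  forall i j, A i j -> J (minor i j).
Proof.
move=> Ji AC JA i j Aij; case: (ltngtP i j) => [ij|ji|/val_inj->].
- exact: JA.
- by rewrite minorC; apply: idealN => //; apply: JA => //; apply: AC.
- by rewrite minorii; case: Ji.
Qed.

Lemma minor_in i j : I (minor i j).
Proof.
apply: (minor_wlog (A := fun _ _ => True)) => // [|{}i {}j ij _].
  exact: ideal_gen_ideal.
apply: sub_ideal_gen; exists (lx hk j), (ly hk i).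
by rewrite binomial_xy //; split=> //; apply: incomparable_xy.
Qed.

Lemma zx_in (j : 'I_n) : (k <= j)%N -> I (z * x j - x ik * y j).
Proof.
move=> kj; apply: sub_ideal_gen; exists (lz hk), (lx hk j).
by rewrite binomial_zx //; split=> //; apply: incomparable_zx.
Qed.

Lemma zy_in (i : 'I_n) : (i < k)%N -> I (z * y i - x i * y ik1).
Proof.
move=> lt_ik; apply: sub_ideal_gen; exists (lz hk), (ly hk i).
by rewrite binomial_zy //; split=> //; apply: incomparable_zy.
Qed.

(** * The ideal of all minors and the ideal P as kernels *)

(** A factor below the top of its class looks like some x_i, a factor divisible
    by v looks like some y_j, and trading v between them turns x_i y_j into
    y_i x_j, which is the minor of columns i and j. *)
Lemma columns_kernel (cls : L -> L) (e : L -> nat) (J : set KL) f :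
  is_ideal J -> (forall i j, J (minor i j)) ->
  (forall i, cls (ly hk i) = cls (lx hk i)) ->
  (forall i, e (ly hk i) = (e (lx hk i)).+1) ->
  (forall t t', cls t = cls t' -> e t = e t' -> J (lvar K t - lvar K t')) ->
  (forall t t', cls t = cls t' -> (e t < e t')%N ->
    exists i, cls t = cls (lx hk i) /\ e t = e (lx hk i)) ->
  (forall s, (0 < e s)%N ->
    exists j, cls s = cls (ly hk j) /\ e s = e (ly hk j)) ->
  torL cls e f = 0 -> J f.
Proof.
move=> Ji Jminor clsy ey Jsame bottom top; apply: torL_kernel => //.
move=> t t' s ct lt_tt' s0; have [i [ci ei]] := bottom _ _ ct lt_tt'.
have [j [cj ej]] := top _ s0; exists (ly hk i), (lx hk j).
split; rewrite ?clsy ?ey ?ej ?ei ?cj //.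
apply: (@ideal_sub_trans _ _ (x i * y j)) => //.
  by apply: ideal_subM => //; apply: Jsame; rewrite ?ci ?cj.
by rewrite [y i * _]mulrC; apply: (Jminor j i).
Qed.

(** The variable x_i of K[L] itself plays the role of a_i, and z is fixed. *)
Definition cls0 (t : L) : L := if t is Some (_, i) then lx hk i else lz hk.
Definition e0 (t : L) : nat := if t is Some (b, _) then nat_of_bool b else 0%N.

Definition minors : set KL := [set f | exists i j, f = minor i j].

Lemma torL0_kernel f : torL cls0 e0 f = 0 -> ideal_gen minors f.
Proof.
have Mi := ideal_gen_ideal minors.
apply: columns_kernel => //.
- by move=> i j; apply: sub_ideal_gen; exists i, j.
- move=> t t' ct et; rewrite (_ : t = t') ?subrr; first by case: Mi.
  by move: ct et; elim/Lk_ind: t => [i|i|]; elim/Lk_ind: t' => [j|j|] //= -[->].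
- by elim/Lk_ind=> [i|i|]; elim/Lk_ind=> [j|j|] // _ _; exists i.
- by elim/Lk_ind=> [i|i|] // _; exists i.
Qed.

Lemma torL0_minor i j : torL cls0 e0 (minor i j) = 0.
Proof. by apply: torL_binomial => //=; rewrite mulrC. Qed.

(** Columns k and k + 1 share the class of x_k, on which x_k, y_k, y_(k+1) have
    exponents 0, 1, 2, and both x_(k+1) and z have exponent 1. *)
Definition clsP (t : L) : L :=
  if t is Some (_, i) then if i == ik1 then lx hk ik else lx hk i
  else lx hk ik.
Definition eP (t : L) : nat :=
  if t is Some (b, i) then (b + (i == ik1))%N else 1%N.

Lemma ik_neq_ik1 : (ik == ik1) = false.
Proof.
apply/eqP => /(congr1 val) /= kk; case/andP: hk => k0 _.
by have /eqP := prednK k0; rewrite kk eqn_leq ltnn.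
Qed.

(** A variable in the class c of exponent e; it makes clsP and eP jointly
    injective modulo the relations z = x_(k+1) = y_k. *)
Definition decodeP (c : L) (e : nat) : L :=
  match e, c with
  | 0, _ => c
  | 1, Some (_, i) => ly hk i
  | _, _ => ly hk ik1
  end.

Lemma torP_kernel (J : set KL) f : is_ideal J -> (forall i j, J (minor i j)) ->
  J (z - x ik1) -> J (z - y ik) -> torL clsP eP f = 0 -> J f.
Proof.
move=> Ji Jminor Jx Jy.
have J0 : J 0 by case: Ji.
have Jdecode t : J (lvar K t - lvar K (decodeP (clsP t) (eP t))).
  elim/Lk_ind: t => [i|i|] //=; case: (eqVneq i ik1) => [->|_] /=;
    rewrite ?subrr //.
  by apply: (ideal_sub_trans Ji _ Jy); apply: ideal_subC.
apply: columns_kernel => //.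
- move=> t t' ct et; apply: ideal_sub_trans (Jdecode t) _ => //.
  by rewrite ct et; exact: (ideal_subC Ji (Jdecode _)).
- elim/Lk_ind=> [i|i|] t'; first by exists i.
    rewrite /=; case: (eqVneq i ik1) => _; case: t' => [[b j]|] //=.
      by case: b; case: eqP.
    case: (eqVneq j ik1) => [_ -> _|_ _]; last by case: b.
    by exists ik1; rewrite /= eqxx.
  by exists ik1; rewrite /= eqxx.
- elim/Lk_ind=> [i|i|] /=; first 1 last.
  + by exists i.
  + by exists ik; rewrite /= ik_neq_ik1.
  + by case: eqP => // _ _; exists ik; rewrite /= ik_neq_ik1.
Qed.

Definition idealP : set KL :=
  ideal_add I (ideal_gen [set z - x ik1; z - y ik]).

Lemma idealPE : idealP =
  ideal_gen (
    [set f | exists a b : L, (a >< b)%O /\ f = join_meet_binomial K a b]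
    `|` [set z - x ik1; z - y ik]).
Proof. exact: ideal_add_gen. Qed.

Lemma idealP_ideal : is_ideal idealP.
Proof. rewrite idealPE; exact: ideal_gen_ideal. Qed.

Lemma join_meet_sub_idealP : I `<=` idealP.
Proof.
move=> f If; exists f => //; exists 0; last by rewrite addr0.
by case: (ideal_gen_ideal [set z - x ik1; z - y ik]).
Qed.

Lemma idealP_x : idealP (z - x ik1).
Proof. by rewrite idealPE; apply: sub_ideal_gen; right; left. Qed.

Lemma idealP_y : idealP (z - y ik).
Proof. by rewrite idealPE; apply: sub_ideal_gen; right; right. Qed.

Lemma idealP_sub (J : set KL) : is_ideal J -> I `<=` J ->
  J (z - x ik1) -> J (z - y ik) -> idealP `<=` J.
Proof.
move=> Ji IJ Jx Jy f [g /IJ Jg [h Hh <-]]; case: (Ji) => _ JD _.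
by apply: JD => //; apply: ideal_gen_sub Hh => // _ [->|->].
Qed.

Lemma idealP_kernel f : idealP f <-> torL clsP eP f = 0.
Proof.
split; last first.
  apply: torP_kernel; [exact: idealP_ideal| |exact: idealP_x|exact: idealP_y].
  by move=> i j; apply: join_meet_sub_idealP; apply: minor_in.
apply: (idealP_sub (J := [set f | torL clsP eP f = 0])).
- exact: kernel_ideal.
- apply: join_meet_ideal_sub; first exact: kernel_ideal.
  + move=> i j _; apply: torL_binomial => /=; last by rewrite mulrC.
    by rewrite addnACA [RHS]addnACA [X in (_ + X)%N]addnC.
  + by move=> j _; apply: torL_binomial; rewrite /= ik_neq_ik1.
  + move=> i lt_ik; apply: torL_binomial => /=.
      have /negPf -> : i != ik1 by rewrite -val_eqE /= neq_ltn lt_ik.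
      by rewrite eqxx.
    by rewrite eqxx mulrC.
- by apply: torL_difference; rewrite /= eqxx.
- by apply: torL_difference; rewrite /= ik_neq_ik1.
Qed.

Lemma idealP_prime : prime_ideal idealP.
Proof. exact: kernel_prime idealP_kernel. Qed.

Lemma idealP_lvar t : ~ idealP (lvar K t).
Proof. by move=> /idealP_kernel /eqP; apply/negP; exact: torL_lvar_neq0. Qed.

(** * Ideals generated by variables and surviving minors *)

Definition survives (S : pred L) (i j : 'I_n) : bool :=
  ~~ [|| S (lx hk i), S (lx hk j), S (ly hk i) | S (ly hk j)].

Definition dead_ideal (S : pred L) : set KL :=
  ideal_gen ([set f | exists2 t, S t & f = lvar K t] `|`
    [set f | exists i j, survives S i j /\ f = minor i j]).

Lemma dead_ideal_ideal S : is_ideal (dead_ideal S).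
Proof. exact: ideal_gen_ideal. Qed.

Lemma dead_lvar (S : pred L) t : S t -> dead_ideal S (lvar K t).
Proof. by move=> St; apply: sub_ideal_gen; left; exists t. Qed.

Lemma dead_ideal_sub (S : pred L) (J : set KL) : is_ideal J ->
  (forall t, S t -> J (lvar K t)) ->
  (forall i j, survives S i j -> J (minor i j)) ->
  dead_ideal S `<=` J.
Proof.
move=> Ji Jt Jm; apply: ideal_gen_sub => // f [[t St ->]|[i [j [Sij ->]]]].
  exact: Jt.
exact: Jm.
Qed.

Definition residue (S : pred L) : KL -> {poly KL} := torL cls0 e0 \o kill S.
HB.instance Definition _ (S : pred L) :=
  GRing.RMorphism.copy (residue S) (torL cls0 e0 \o kill S).

Lemma residueE (S : pred L) f : residue S f = torL cls0 e0 (kill S f).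
Proof. by []. Qed.

Lemma dead_ideal_residue (S : pred L) f : dead_ideal S f -> residue S f = 0.
Proof.
apply: (dead_ideal_sub (J := [set f | residue S f = 0])).
- exact: (kernel_ideal (residue S)).
- by move=> t St; rewrite /mkset residueE kill_lvar St rmorph0.
- move=> i j; rewrite /survives !negb_or => /and4P[Sxi Sxj Syi Syj].
  by rewrite /mkset residueE kill_binomial //; exact: torL0_minor.
Qed.

Lemma dead_lvarE (S : pred L) t : dead_ideal S (lvar K t) <-> S t.
Proof.
split=> [/dead_ideal_residue|]; last exact: dead_lvar.
rewrite residueE kill_lvar; case: (S t) => // /eqP.
by rewrite (negPf (torL_lvar_neq0 _ _ _ _)).
Qed.

(** In each minor both terms die or neither does; otherwise the minor would be
    congruent, up to sign, to a monomial in the surviving variables. *)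
Definition balanced (S : pred L) := forall i j,
  S (lx hk j) || S (ly hk i) = S (lx hk i) || S (ly hk j).

Lemma dead_minor (S : pred L) :
  balanced S -> forall i j, dead_ideal S (minor i j).
Proof.
move=> balS i j; have Si := dead_ideal_ideal S.
have [alive|] := boolP (survives S i j).
  by apply: sub_ideal_gen; right; exists i, j.
rewrite negbK => some.
have dd a b : S a || S b -> dead_ideal S (lvar K a * lvar K b).
  case/orP => /dead_lvar Sv; first exact: idealMr.
  by rewrite mulrC; apply: idealMr.
by apply: idealB => //; apply: dd; have := balS i j; move: some;
  do 4!case: (S _).
Qed.

(** Modulo the dead variables f is its image under [kill S], and the kernel of
    the first substitution is generated by minors, all of which lie in the ideal
    when S is balanced. *)
Lemma dead_ideal_prime (S : pred L) : balanced S -> prime_ideal (dead_ideal S).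
Proof.
move=> balS; have Si := dead_ideal_ideal S.
apply: (kernel_prime (phi := residue S)) => f.
split; first exact: dead_ideal_residue.
rewrite /= residueE => /torL0_kernel Mf.
have Jkill g : dead_ideal S (g - kill S g).
  by apply: kill_cong => //; exact: dead_lvar.
rewrite -[f](subrK (kill S f)); case: (Si) => _ JD _; apply: JD => //.
apply: (ideal_gen_sub Si _ Mf) => _ [i [j ->]]; exact: dead_minor.
Qed.

(** * The six patterns of killed variables *)

Local Notation pattern := (bool * bool * bool * bool * bool)%type.

(** The bits stand for z, the x_i with i <= k, the x_i with i > k, the y_i with
    i <= k and the y_i with i > k. *)
Definition block (w : pattern) : pred L := fun t =>
  let: (zd, xl, xh, yl, yh) := w in
  match t with
  | None => zd
  | Some (false, i) => if (i < k)%N then xl else xh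
  | Some (true, i) => if (i < k)%N then yl else yh
  end.

(** In order: P1, P1', P2, P2', P3, P3'. *)
Definition patterns : seq pattern :=
  [:: (true, true, true, false, false); (true, false, false, true, true);
      (true, true, false, true, false); (true, false, true, false, true);
      (false, true, true, true, false); (false, false, true, true, true)].

Lemma ik_low : (ik < k)%N.
Proof. by rewrite /= -ltnS prednK //; case/andP: hk. Qed.

Lemma block_balanced w : w \in patterns -> balanced (block w).
Proof.
by rewrite !inE => wP i j; move: wP; do 5?[case/orP]; move/eqP->; rewrite /=;
  do 2!case: ifP.
Qed.

(** Each pattern kills a variable of both terms of every generator that is not a
    minor. *)
Lemma join_meet_sub_block w : w \in patterns -> I `<=` dead_ideal (block w).
Proof.
move=> wP; have Si := dead_ideal_ideal (block w).
have dd a b a' b' : block w a || block w b -> block w a' || block w b' ->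
    dead_ideal (block w) (lvar K a * lvar K b - lvar K a' * lvar K b').
  have d c c' : block w c || block w c' ->
      dead_ideal (block w) (lvar K c * lvar K c').
    case/orP => /dead_lvar Sv; first exact: idealMr.
    by rewrite mulrC; apply: idealMr.
  by move=> /d ab /d; apply: idealB.
apply: join_meet_ideal_sub => //.
- by move=> i j _; apply: dead_minor; apply: block_balanced.
- move=> j; rewrite leqNgt => /negPf jk; apply: dd; move: wP; rewrite !inE;
  by do 5?[case/orP]; move/eqP->; rewrite /= ?jk ?[(_ < k)%N]ik_low.
- move=> i lt_ik; apply: dd; move: wP; rewrite !inE;
  by do 5?[case/orP]; move/eqP->; rewrite /= ?lt_ik ?ltnn.
Qed.

(** Each of the six patterns has exactly three bits set, so an inclusion between
    two of them is an equality. *)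
Lemma sub_block w w' : w \in patterns -> w' \in patterns ->
  dead_ideal (block w) `<=` dead_ideal (block w') -> w = w'.
Proof.
move=> wP w'P ww'.
have sub t : block w t ==> block w' t.
  by apply/implyP => /dead_lvar/ww'/dead_lvarE.
move: (sub (lz hk)) (sub (lx hk ik)) (sub (lx hk ik1)).
move: (sub (ly hk ik)) (sub (ly hk ik1)); move: wP w'P.
rewrite !inE; do 5?[case/orP]; move/eqP->; do 5?[case/orP]; move/eqP->;
  by rewrite //= ltnn [(_ < k)%N]ik_low.
Qed.

(** An ideal that contains both differences of P contains all or none of z,
    x_(k+1) and y_k, and every pattern separates two of them. *)
Lemma idealP_not_sub_block w :
  w \in patterns -> ~ idealP `<=` dead_ideal (block w).
Proof.
move=> wP Pw; have Si := dead_ideal_ideal (block w).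
have cong t : idealP (z - lvar K t) -> block w (lz hk) = block w t.
  move=> /Pw Jzt; apply/idP/idP => /dead_lvar Sv; apply/dead_lvarE.
    rewrite -[lvar K t](subKr z); exact: idealB.
  by rewrite -[z](subrK (lvar K t)); case: (Si) => _ JD _; apply: JD.
move: wP (cong _ idealP_x) (cong _ idealP_y); rewrite !inE.
by do 5?[case/orP]; move/eqP->; rewrite /= ltnn [(_ < k)%N]ik_low.
Qed.

Lemma block_not_sub_idealP w :
  w \in patterns -> ~ dead_ideal (block w) `<=` idealP.
Proof.
move=> wP wsub; have alive t : block w t = false.
  by apply/negP => /dead_lvar/wsub; exact: idealP_lvar.
move: wP (alive (lz hk)) (alive (lx hk ik1)); rewrite !inE.
by do 5?[case/orP]; move/eqP->; rewrite /= ltnn.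
Qed.

Definition contains_block (w : pattern) (G : set KL) : Prop :=
  let: (zd, xl, xh, yl, yh) := w in
  [/\ zd -> G z, xl -> forall i : 'I_n, (i < k)%N -> G (x i),
    xh -> forall i : 'I_n, (k <= i)%N -> G (x i),
    yl -> forall i : 'I_n, (i < k)%N -> G (y i) &
    yh -> forall i : 'I_n, (k <= i)%N -> G (y i)].

Lemma contains_blockP w G :
  contains_block w G -> forall t, block w t -> G (lvar K t).
Proof.
case: w => [[[[zd xl] xh] yl] yh] [Gz Gxl Gxh Gyl Gyh].
elim/Lk_ind=> [i|i|] //=; case: ltnP => ik bit.
- exact: Gxl.
- exact: Gxh.
- exact: Gyl.
- exact: Gyh.
Qed.

(** * The primes over the join-meet ideal *)

Lemma prime_products (A B : Type) (Q : set KL) (a : set A) (b : set B) u v :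
  prime_ideal Q -> (forall i j, a i -> b j -> Q (u i * v j)) ->
  (forall i, a i -> Q (u i)) \/ (forall j, b j -> Q (v j)).
Proof.
move=> /prime_idealE[_ QM] Quv.
have [|/existsNP[i /not_implyP[Ai nQi]]] := pselect (forall i, a i -> Q (u i)).
  by left.
by right=> j Bj; case: (QM _ _ (Quv i j Ai Bj)).
Qed.

Lemma prime_cover (Q : set KL) : prime_ideal Q -> I `<=` Q ->
  idealP `<=` Q \/ exists2 w, w \in patterns & dead_ideal (block w) `<=` Q.
Proof.
move=> Qp IQ; have [Qi QM] := prime_idealE Qp; have [Q0 QD QC] := Qi.
have Qminor i j : Q (minor i j) by apply: IQ; apply: minor_in.
pose low := [set i : 'I_n | (i < k)%N].
pose high := [set i : 'I_n | (k <= i)%N].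
have blockI w : contains_block w Q -> dead_ideal (block w) `<=` Q.
  by move=> wQ; apply: dead_ideal_sub => //; exact: contains_blockP.
have xz : (forall j, high j -> Q (x j)) \/ Q (z - y ik).
  have [j _ kj _|xh|zy] := @prime_products _ _ Q high [set: unit]
    (fun j => x j) (fun=> z - y ik) Qp; [|by left|by right; exact: (zy tt)].
  rewrite [X in Q X](_ : _ = (z * x j - x ik * y j) + minor j ik).
    by apply: QD => //; apply: IQ; apply: zx_in.
  by rewrite /minor; ring.
have yz : (forall i, low i -> Q (y i)) \/ Q (z - x ik1).
  have [i _ ki _|yl|zx] := @prime_products _ _ Q low [set: unit]
    (fun i => y i) (fun=> z - x ik1) Qp; [|by left|by right; exact: (zx tt)].
  rewrite [X in Q X](_ : _ = (z * y i - x i * y ik1) + minor ik1 i).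
    by apply: QD => //; apply: IQ; apply: zy_in.
  by rewrite /minor; ring.
have xy : (forall j, high j -> Q (x j)) \/ (forall i, low i -> Q (y i)) ->
    (forall i, low i -> Q (x i)) \/ (forall j, high j -> Q (y j)).
  move=> xhyl; apply: prime_products => // i j li hj.
  rewrite [X in Q X](_ : _ = x j * y i - minor i j); last first.
    by rewrite /minor; ring.
  apply: idealB => //; case: xhyl => [xh|yl]; last by apply: QC; exact: yl.
  by apply: idealMr => //; exact: xh.
have zE v : Q (z - v) -> Q v -> Q z.
  by move=> Qzv Qv; rewrite -[z](subrK v); apply: QD.
case: xz yz => [xh|zy] [yl|zx].
- right; have [xl|yh] := xy (or_introl xh).
    by exists (false, true, true, true, false) => //; apply: blockI.
  by exists (false, false, true, true, true) => //; apply: blockI.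
- have Qz : Q z by apply: (zE _ zx); apply: xh; exact: leqnn.
  right; have [xl|yh] := xy (or_introl xh).
    by exists (true, true, true, false, false) => //; apply: blockI.
  by exists (true, false, true, false, true) => //; apply: blockI.
- have Qz : Q z by apply: (zE _ zy); apply: yl; exact: ik_low.
  right; have [xl|yh] := xy (or_intror yl).
    by exists (true, true, false, true, false) => //; apply: blockI.
  by exists (true, false, false, true, true) => //; apply: blockI.
- by left; apply: idealP_sub.
Qed.

Lemma minimal_primes_join_meet :
  minimal_primes I =
  [set idealP] `|` [set dead_ideal (block w) | w in [set` patterns]].
Proof.
apply: minimal_primesP.
- move=> _ [->|[w wP <-]]; split.
  + exact: idealP_prime.
  + exact: join_meet_sub_idealP.
  + by apply: dead_ideal_prime; apply: block_balanced.
  + exact: join_meet_sub_block.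
- move=> Q Qp IQ; have [PQ|[w wP wQ]] := prime_cover Qp IQ.
    by exists idealP => //; left.
  by exists (dead_ideal (block w)) => //; right; exists w.
- move=> _ _ [->|[w wP <-]] [->|[w' w'P <-]] //.
  + by move/(idealP_not_sub_block w'P).
  + by move/(block_not_sub_idealP wP).
  + by move/(sub_block wP w'P) ->.
Qed.

Lemma block_gen w (G : set KL) :
  (forall g, G g -> dead_ideal (block w) g) ->
  contains_block w G ->
  (forall i j : 'I_n, survives (block w) i j -> ideal_gen G (minor i j)) ->
  ideal_gen G = dead_ideal (block w).
Proof.
move=> Gw wG Gm; apply/seteqP; split.
  exact: ideal_gen_sub (dead_ideal_ideal _) Gw.
apply: dead_ideal_sub => //; first exact: ideal_gen_ideal.
by move=> t wt; apply: sub_ideal_gen; exact: contains_blockP wt.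
Qed.

Lemma sub_ideal_minor (S : latticeClosed L) (A : set 'I_n) :
  (forall i, A i -> lx hk i \in S /\ ly hk i \in S) ->
  forall i j, A i -> A j -> sub_join_meet_ideal K S (minor i j).
Proof.
move=> AS i j Ai Aj; apply: (minor_wlog (A := fun i j => A i /\ A j)) => //.
- exact: ideal_gen_ideal.
- by move=> ? ? [].
move=> {Ai Aj}i {}j ij [Ai Aj]; apply: sub_ideal_gen.
have [[_ ySi] [xSj _]] := (AS i Ai, AS j Aj).
exists (lx hk j), (ly hk i); split; [exact: xSj|exact: ySi| |].
  exact: incomparable_xy.
by rewrite binomial_xy.
Qed.

End LkPrimes.

Theorem theorem4p2 (K : fieldType) (n k : nat) (hk : (0 < k < n)%N) :
  let x (i : 'I_n) := lvar K (lx hk i) in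
  let y (i : 'I_n) := lvar K (ly hk i) in
  let z := lvar K (lz hk) in
  let low := [set i : 'I_n | (i < k)%N] in
  let high := [set i : 'I_n | (k <= i)%N] in
  let I := join_meet_ideal K (Lk hk) in
  let I_Dk := sub_join_meet_ideal K (Dk hk) in
  let I_Dk' := sub_join_meet_ideal K (Dk' hk) in
  let P := ideal_add I (ideal_gen [set z - x (idx_k1 hk); z - y (idx_k hk)]) in
  let P1 := ideal_gen ([set z] `|` range x) in
  let P1' := ideal_gen ([set z] `|` range y) in
  let P2 := ideal_add (ideal_gen ([set z] `|` x @` low `|` y @` low)) I_Dk' in
  let P2' := ideal_add (ideal_gen ([set z] `|` x @` high `|` y @` high)) I_Dk in
  let P3 := ideal_gen (range x `|` y @` low) in
  let P3' := ideal_gen (range y `|` x @` high) in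
  minimal_primes I = [set P; P1; P1'; P2; P2'; P3; P3'].
Proof.
move=> x y z low high I I_Dk I_Dk' P P1 P1' P2 P2' P3 P3'.
have binomial_in (w : bool * bool * bool * bool * bool) (a b : Lk hk) :
    w \in patterns -> (a >< b)%O ->
    dead_ideal (block w) (join_meet_binomial K a b).
  move=> wP ab; apply: join_meet_sub_block => //; apply: sub_ideal_gen.
  by exists a, b.
have dead_in w (t : Lk hk) : block w t -> dead_ideal (block w) (lvar K t).
  exact: dead_lvar.
have P1E : P1 = dead_ideal (block (true, true, true, false, false)).
  apply: block_gen.
  - by move=> _ [->|[i _ <-]]; apply: dead_in => //=; case: ifP.
  - by split=> // [_|_ i _|_ i _]; [left | right; exists i | right; exists i].
  - by move=> i j; rewrite /survives /=; case: (ltnP i k); case: (ltnP j k).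
have P1'E : P1' = dead_ideal (block (true, false, false, true, true)).
  apply: block_gen.
  - by move=> _ [->|[i _ <-]]; apply: dead_in => //=; case: ifP.
  - by split=> // [_|_ i _|_ i _]; [left | right; exists i | right; exists i].
  - by move=> i j; rewrite /survives /=; case: (ltnP i k); case: (ltnP j k).
have P3E : P3 = dead_ideal (block (false, true, true, true, false)).
  apply: block_gen.
  - move=> _ [[i _ <-]|[i ik <-]]; apply: dead_in => /=; first by case: ifP.
    by rewrite ik.
  - by split=> // _ i ik; [left; exists i | left; exists i | right; exists i].
  - by move=> i j; rewrite /survives /=; case: (ltnP i k); case: (ltnP j k).
have P3'E : P3' = dead_ideal (block (false, false, true, true, true)).
  apply: block_gen.
  - move=> _ [[i _ <-]|[i ki <-]]; apply: dead_in => /=; first by case: ifP.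
    by rewrite ltnNge ki.
  - by split=> // _ i ki; [right; exists i | left; exists i | left; exists i].
  - by move=> i j; rewrite /survives /=; case: (ltnP i k); case: (ltnP j k).
have P2E : P2 = dead_ideal (block (true, true, false, true, false)).
  rewrite /P2 /I_Dk' /sub_join_meet_ideal ideal_add_gen; apply: block_gen.
  - move=> _ [[[->|[i ik <-]]|[i ik <-]]|[a [b [_ _ ab ->]]]].
    + exact: dead_in.
    + by apply: dead_in; rewrite /= ik.
    + by apply: dead_in; rewrite /= ik.
    + exact: binomial_in.
  - split=> // [_|_ i ik|_ i ik]; left.
    + by left; left.
    + by left; right; exists i.
    + by right; exists i.
  - move=> i j; rewrite /survives /=.
    case: (ltnP i k) => //; case: (ltnP j k) => // kj ki _.
    have : I_Dk' (minor K hk i j).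
      by apply: (@sub_ideal_minor K n k hk (Dk' hk) high).
    apply: ideal_gen_sub; first exact: ideal_gen_ideal.
    by move=> f If; apply: sub_ideal_gen; right.
have P2'E : P2' = dead_ideal (block (true, false, true, false, true)).
  rewrite /P2' /I_Dk /sub_join_meet_ideal ideal_add_gen; apply: block_gen.
  - move=> _ [[[->|[i ki <-]]|[i ki <-]]|[a [b [_ _ ab ->]]]].
    + exact: dead_in.
    + by apply: dead_in; rewrite /= ltnNge ki.
    + by apply: dead_in; rewrite /= ltnNge ki.
    + exact: binomial_in.
  - split=> // [_|_ i ki|_ i ki]; left.
    + by left; left.
    + by left; right; exists i.
    + by right; exists i.
  - move=> i j; rewrite /survives /=.
    case: (ltnP i k) => //; case: (ltnP j k) => // jk ik _.
    have : I_Dk (minor K hk i j).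
      by apply: (@sub_ideal_minor K n k hk (Dk hk) low).
    apply: ideal_gen_sub; first exact: ideal_gen_ideal.
    by move=> f If; apply: sub_ideal_gen; right.
rewrite minimal_primes_join_meet P1E P1'E P2E P2'E P3E P3'E.
apply/seteqP; split=> Q.
  move=> [->|[w + <-]]; first by do 6!left.
  rewrite /= !inE.
  case/orP => [/eqP->|]; first by do 5!left; right.
  case/orP => [/eqP->|]; first by do 4!left; right.
  case/orP => [/eqP->|]; first by do 3!left; right.
  case/orP => [/eqP->|]; first by do 2!left; right.
  by case/orP => /eqP->; [left; right | right].
move=> [[[[[[->|->]|->]|->]|->]|->]|->]; first by left.
all: by right; eexists; last by [].
Qed.
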